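(* As formal power series, $$\sum_{\pi \in I(3412)} q^{lrmax(\pi)} x^{|\pi|} = \sum_{\pi \in I(3412)} q^{rlmin(\pi)} x^{|\pi|} = \cfrac{1}{1-xq - \cfrac{x^2 q}{1-x - \cfrac{x^2}{1-x - \cfrac{x^2}{1-x - \cdots}}}},$$ where in the continued fraction the initial denominator term is $1-xq$, the first subtracted numerator is $x^2q$, all later numerators are $x^2$, and all later denominator terms are $1-x$.
   Context: $I(3412)$ denotes the set of all involutions (of all lengths $n\ge 0$, including the empty permutation), in one-line notation, which avoid $3412$, i.e. have no subsequence in the same relative order as $3412$. $|\pi|$ is the length of $\pi$. A left-to-right maximum of $\pi$ is an entry greater than all entries to its left; a right-to-left minimum is an entry less than all entries to its right. $lrmax(\pi)$ and $rlmin(\pi)$ are the numbers of left-to-right maxima and right-to-left minima of $\pi$. The infinite continued fraction is the formal-power-series limit of its finite truncations. *)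

(* Defs.v *)
(* Mathematical Components; `boolp` only supplies extensional, decidable
   equality and choice on power series. *)
From HB Require Import structures.
From mathcomp Require Import all_boot all_order all_algebra all_fingroup.
From mathcomp Require Import boolp.

Set Implicit Arguments.
Unset Strict Implicit.
Unset Printing Implicit Defensive.

Import GRing.Theory.

Local Open Scope ring_scope.

(* The ring R[[x]]; f n is the coefficient of x^n in f. *)
Record fps (R : Type) := FPS { coef_fps :> nat -> R }.

HB.instance Definition _ (R : Type) := gen_eqMixin (fps R).
HB.instance Definition _ (R : Type) := gen_choiceMixin (fps R).

Lemma fpsP (R : Type) (f g : fps R) : (forall n, f n = g n) -> f = g.
Proof. by case: f => f; case: g => g /= fg; congr FPS; apply: funext. Qed.

Section FpsZmod.
Variable R : zmodType.
Implicit Types f g : fps R.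

Definition fps_zero : fps R := FPS (fun=> 0).
Definition fps_opp f : fps R := FPS (fun n => - f n).
Definition fps_add f g : fps R := FPS (fun n => f n + g n).

Fact fps_addA : associative fps_add.
Proof. by move=> f g h; apply: fpsP => n /=; rewrite addrA. Qed.
Fact fps_addC : commutative fps_add.
Proof. by move=> f g; apply: fpsP => n /=; rewrite addrC. Qed.
Fact fps_add0 : left_id fps_zero fps_add.
Proof. by move=> f; apply: fpsP => n /=; rewrite add0r. Qed.
Fact fps_addN : left_inverse fps_zero fps_opp fps_add.
Proof. by move=> f; apply: fpsP => n /=; rewrite addNr. Qed.

HB.instance Definition _ :=
  GRing.isZmodule.Build (fps R) fps_addA fps_addC fps_add0 fps_addN.
End FpsZmod.

Section FpsRing.
Variable R : comNzRingType.
Implicit Types f g : fps R.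

Definition fpsC (c : R) : fps R := FPS (fun n => if n is 0 then c else 0).
Definition fpsX : fps R := FPS (fun n => (n == 1)%:R).
Definition fps_mul f g : fps R :=
  FPS (fun n => \sum_(i < n.+1) f i * g (n - i)%N).

Definition fps_trunc n f : {poly R} := \poly_(i < n.+1) f i.

Lemma coef_fps_mul n f g (p q : {poly R}) :
    (forall i, (i <= n)%N -> f i = p`_i) ->
    (forall i, (i <= n)%N -> g i = q`_i) ->
  fps_mul f g n = (p * q)`_n.
Proof.
move=> fp gq; rewrite coefM; apply: eq_bigr => i _.
by rewrite fp ?gq ?leq_subr // -ltnS.
Qed.

Lemma coef_fps_trunc n f i : (i <= n)%N -> f i = (fps_trunc n f)`_i.
Proof. by move=> le_in; rewrite coef_poly ltnS le_in. Qed.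

Lemma coef_fps_mul_trunc n f g i : (i <= n)%N ->
  fps_mul f g i = (fps_trunc n f * fps_trunc n g)`_i.
Proof.
by move=> le_in; apply: coef_fps_mul => j le_ji;
  apply: coef_fps_trunc; apply: leq_trans le_in.
Qed.

Fact fps_mulA : associative fps_mul.
Proof.
move=> f g h; apply: fpsP => n.
rewrite (coef_fps_mul (coef_fps_trunc f (n := n)) (@coef_fps_mul_trunc n g h)).
by rewrite (coef_fps_mul (@coef_fps_mul_trunc n f g)
                         (coef_fps_trunc h (n := n))) mulrA.
Qed.
Fact fps_mulC : commutative fps_mul.
Proof.
by move=> f g; apply: fpsP => n; rewrite !(@coef_fps_mul_trunc n) // mulrC.
Qed.
Fact fps_mul1 : left_id (fpsC 1) fps_mul.
Proof.
move=> f; apply: fpsP => n /=; rewrite big_ord_recl /= mul1r subn0.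
by rewrite big1 ?addr0 // => i _; rewrite mul0r.
Qed.
Fact fps_mulDl : left_distributive fps_mul (@fps_add R).
Proof.
move=> f g h; apply: fpsP => n /=; rewrite -big_split /=.
by apply: eq_bigr => i _; rewrite mulrDl.
Qed.
Fact fps_1neq0 : fpsC 1 != fps_zero R.
Proof.
apply/eqP => /(congr1 (fun f : fps R => f 0)) /= /eqP.
by rewrite oner_eq0.
Qed.

HB.instance Definition _ := GRing.Zmodule_isComNzRing.Build (fps R)
  fps_mulA fps_mulC fps_mul1 fps_mulDl fps_1neq0.
End FpsRing.

Arguments fpsX {R}.

Section FpsUnitRing.
Variable R : comUnitRingType.
Implicit Types f g : fps R.

(* The coefficients g_0, ..., g_n of the inverse g of f, from
   f_0 g_0 = 1 and f_0 g_n = - \sum_(1 <= i <= n) f_i g_(n-i). *)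
Fixpoint fps_inv_seq f n : seq R :=
  if n is m.+1 then
    let s := fps_inv_seq f m in
    rcons s (- ((f 0)^-1 * \sum_(i < n) f i.+1 * s`_(m - i)))
  else [:: (f 0)^-1].

Definition fps_unit : {pred fps R} := fun f => f 0 \is a GRing.unit.

Definition fps_inv f : fps R :=
  if f 0 \is a GRing.unit then FPS (fun n => (fps_inv_seq f n)`_n) else f.

Lemma size_fps_inv_seq f n : size (fps_inv_seq f n) = n.+1.
Proof. by elim: n => //= n IHn; rewrite size_rcons IHn. Qed.

Lemma nth_fps_inv_seq f n i : (i <= n)%N ->
  (fps_inv_seq f n)`_i = (fps_inv_seq f i)`_i.
Proof.
elim: n => [|n IHn]; first by rewrite leqn0 => /eqP->.
rewrite leq_eqVlt => /predU1P[-> //|]; rewrite ltnS => le_in.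
by rewrite [in LHS]/= nth_rcons size_fps_inv_seq ltnS le_in IHn.
Qed.

Fact fps_mulVr : {in fps_unit, left_inverse 1 fps_inv *%R}.
Proof.
move=> f; rewrite unfold_in => Uf; rewrite mulrC; apply: fpsP => n.
rewrite /fps_inv Uf; case: n => [|n].
  by rewrite /GRing.mul /= big_ord1 /= mulrV.
rewrite /GRing.mul [LHS]/= big_ord_recl [X in f _ * X]/=.
rewrite subn0 nth_rcons size_fps_inv_seq ltnn eqxx mulrN mulVKr //.
apply/eqP; rewrite addrC subr_eq0; apply/eqP/eq_bigr => i _ /=.
by rewrite [in RHS]nth_fps_inv_seq ?leq_subr.
Qed.
Fact fps_unitPl f g : g * f = 1 -> fps_unit f.
Proof.
move=> /(congr1 (fun f : fps R => f 0)).
rewrite /GRing.mul /GRing.one /= big_ord1 => gf1.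
by apply/unitrPr; exists (g 0); rewrite mulrC.
Qed.
Fact fps_inv_out : {in [predC fps_unit], fps_inv =1 id}.
Proof. by move=> f; rewrite inE unfold_in /fps_inv => /negPf->. Qed.

HB.instance Definition _ := GRing.ComNzRing_hasMulInverse.Build (fps R)
  fps_mulVr fps_unitPl fps_inv_out.
End FpsUnitRing.

(* Convergence for the x-adic topology with discrete coefficients: each
   coefficient is eventually constant. *)
Definition fps_cvg (R : Type) (u : nat -> fps R) (f : fps R) : Prop :=
  forall n, exists N, forall k, (N <= k)%N -> u k n = f n.

(* a_j / (b_j - a_(j+1) / (b_(j+1) - ... - a_(j+m) / b_(j+m))) *)
Fixpoint cfrac (F : unitRingType) (a b : nat -> F) (m j : nat) : F :=
  if m is m'.+1 then a j / (b j - cfrac a b m' j.+1) else a j / b j.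

(* Positions and values range over 0, ..., n-1 rather than 1, ..., n; the
   pattern p may use any distinct numbers, as only their order matters. *)
Definition contains (n : nat) (s : 'S_n) (p : seq nat) : bool :=
  [exists f : {ffun 'I_(size p) -> 'I_n},
    [forall i : 'I_(size p), forall j : 'I_(size p), (i < j) ==>
      (f i < f j) && ((s (f i) < s (f j)) == (nth 0 p i < nth 0 p j))]]%N.

Definition avoids (n : nat) (s : 'S_n) (p : seq nat) : bool :=
  ~~ contains s p.

Definition perm_involution (n : nat) (s : 'S_n) : bool :=
  [forall i, s (s i) == i].

Definition I3412 (n : nat) : {set 'S_n} :=
  [set s | perm_involution s & avoids s [:: 3; 4; 1; 2]%N].

Definition lrmax (n : nat) (s : 'S_n) : nat :=
  #|[set i : 'I_n | [forall j : 'I_n, (j < i) ==> (s j < s i)]]|%N.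

Definition rlmin (n : nat) (s : 'S_n) : nat :=
  #|[set i : 'I_n | [forall j : 'I_n, (i < j) ==> (s i < s j)]]|%N.

(* Series in x over Z[q], the indeterminate q being 'X : {poly int}.
   Permutations of length n are exactly those contributing to x^n, so the sum
   over all of I(3412) has the following coefficients. *)
Definition I3412_gf (st : forall n, 'S_n -> nat) : fps {poly int} :=
  FPS (fun n => \sum_(s in I3412 n) 'X^(st n s)).

Definition xvar : fps {poly int} := fpsX.
Definition qvar : fps {poly int} := fpsC 'X.

Definition cf_num (j : nat) : fps {poly int} :=
  match j with
  | 0 => 1
  | 1 => xvar ^+ 2 * qvar
  | _ => xvar ^+ 2
  end.

Definition cf_den (j : nat) : fps {poly int} :=
  if j is 0 then 1 - xvar * qvar else 1 - xvar.

(* Main.v *)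
Require Import Defs.
From mathcomp Require Import all_boot all_order all_algebra all_fingroup.
From mathcomp Require Import zify ring.

Set Implicit Arguments.
Unset Strict Implicit.
Unset Printing Implicit Defensive.

Import GRing.Theory.

(** Draw an involution as a set of arcs [i -- s i], fixed points being isolated
    vertices.  An involution avoids 3412 exactly when no two of its arcs cross
    ([I3412P]): two crossing arcs [i < j < s i < s j] are a 3412, and conversely
    a 3412 forces a crossing.

    In such a picture consider the first block: the interval [0 .. s 0] under
    the arc of [0], or [{0}] if [0] is fixed.  As arcs do not cross, [s] is the
    direct sum of its restriction to this block and of an arbitrary noncrossing
    involution of the other points.  The block itself is a fixed point, or an
    arc around an arbitrary noncrossing involution.  The value [0] is taken at
    the last position of the block, so this position is the only right-to-left
    minimum in the block, and the right-to-left minima of [s] are this one and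
    those of the rest.  If [F q] denotes the generating series by length and
    [rlmin], this decomposition ([sum_first_block], [card_first_blocks0],
    [card_first_blocksS]) reads
<<
      F q = 1 + x q F q + x^2 q (F 1) (F q),
>>
    that is, [F q = 1 / (1 - x q - x^2 q F 1)] ([rlmin_fpsE]).  For [q = 1] the
    series [F 1] is thus the fixed point of [f |-> 1 / (1 - x - x^2 f)], whose
    iteration builds the tails of the continued fraction.  Each step of the
    iteration gains a power of [x] in accuracy ([cf_tail]), which gives the
    convergence.

    The equality of the two distributions holds permutation by permutation: [s]
    maps the positions of the left-to-right maxima of [s] onto the positions of
    the right-to-left minima of [s^-1] ([lrmax_rlminV]), and [s^-1 = s]. *)

(** * 3412-avoiding involutions and noncrossing arcs *)

(** Cutting and pasting permutations changes their length.  All surgery is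
    therefore done on functions [nat -> nat], of which only the values below
    the length matter; [act] and [perm_of_fun] translate from and to the types
    ['S_n]. *)
Definition act n (s : 'S_n) (i : nat) : nat :=
  if insub i is Some j then val (s j) else i.

Definition perm_of_fun n (f : nat -> nat) : 'S_n :=
  insubd (1%g : {perm _}) [ffun i : 'I_n => insubd i (f i)].

(** Field [nc_nest] looks only at points inside the arc of [i], and bounds
    [f j] only from above; this does exclude all crossings, because
    [f j < i < j < f i] violates it for the pair [f j < i]. *)
Record noncrossing n (f : nat -> nat) : Prop := Noncrossing {
  nc_bound : forall i, i < n -> f i < n;
  nc_inv : forall i, i < n -> f (f i) = i;
  nc_nest : forall i j, i < n -> i < j < f i -> f j < f i }.

Lemma actE n (s : 'S_n) (i : 'I_n) : act s i = s i.
Proof. by rewrite /act valK. Qed.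

Lemma act_inj n (s t : 'S_n) :
  (forall i, i < n -> act s i = act t i) -> s = t.
Proof. by move=> st; apply/permP => i; apply/val_inj; rewrite /= -!actE st. Qed.

Lemma eq_noncrossing n f g :
  (forall i, i < n -> f i = g i) -> noncrossing n f -> noncrossing n g.
Proof.
move=> fg [fb fi fn]; split=> [i lt_in|i lt_in|i j lt_in].
- by rewrite -fg // fb.
- by rewrite -(fg i) // -fg ?fb // fi.
move=> /andP[ij]; rewrite -fg // => jf; rewrite -fg ?fn ?ij //.
by have := fb i lt_in; lia.
Qed.

Lemma act_perm_of_fun n f i :
  noncrossing n f -> i < n -> act (perm_of_fun n f) i = f i.
Proof.
move=> [fb fi _] lt_in; rewrite -[i]/(val (Ordinal lt_in)) actE /perm_of_fun.
have fE (j : 'I_n) : val (insubd j (f j)) = f j by rewrite insubdK // unfold_in fb.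
have inj : injectiveb [ffun j : 'I_n => insubd j (f j)].
  apply/injectiveP => j k; rewrite !ffunE => /(congr1 val); rewrite !fE => jk.
  by apply: val_inj; rewrite /= -(fi j) // jk fi.
by rewrite -pvalE -[pval _]/(val _) insubdK //= ffunE fE.
Qed.

Lemma noncrossing_perm_of_fun n f :
  noncrossing n f -> noncrossing n (act (perm_of_fun n f)).
Proof.
by move=> nc; apply: eq_noncrossing (nc) => i lt_in; rewrite act_perm_of_fun.
Qed.

Lemma act_inv n (s : 'S_n) : perm_involution s ->
  forall i, i < n -> act s (act s i) = i.
Proof.
by move=> /forallP inv i lt_in; rewrite -[i]/(val (Ordinal lt_in)) !actE (eqP (inv _)).
Qed.

Lemma act_bound n (s : 'S_n) i : i < n -> act s i < n.
Proof. by move=> lt_in; rewrite -[i]/(val (Ordinal lt_in)) actE. Qed.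

(** The order of the four values is fixed by the three comparisons given by the
    pairs of positions (0,1), (2,3) and (0,3). *)
Lemma contains3412P n (s : 'S_n) :
  reflect (exists a b c d, [/\ a < b < c, c < d < n, act s c < act s d < act s a
                             & act s a < act s b])
          (contains s [:: 3; 4; 1; 2]).
Proof.
apply: (iffP existsP) => [[f /forallP H]|[a [b [c [d [abc cd v1 v2]]]]]].
  have {}H (i j : 'I_4) : i < j ->
      (f i < f j) && ((act s (f i) < act s (f j))
         == (nth 0 [:: 3; 4; 1; 2] i < nth 0 [:: 3; 4; 1; 2] j)).
    by move=> ij; rewrite !actE; move/forallP/(_ j)/implyP: (H i); apply.
  have /andP[l01 /eqP e01] := H (@Ordinal 4 0 isT) (@Ordinal 4 1 isT) isT.
  have /andP[l12 _] := H (@Ordinal 4 1 isT) (@Ordinal 4 2 isT) isT.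
  have /andP[l23 /eqP e23] := H (@Ordinal 4 2 isT) (@Ordinal 4 3 isT) isT.
  have /andP[l03 /eqP e03] := H (@Ordinal 4 0 isT) (@Ordinal 4 3 isT) isT.
  set a := f (Ordinal _) in l01 l03 e01 e03; set b := f (Ordinal _) in l01 l12 e01.
  set c := f (Ordinal _) in l12 l23 e23; set d := f (Ordinal _) in l03 l23 e03 e23.
  (* The pattern only gives ~ (s a < s d); strictness needs injectivity. *)
  have ne : act s d <> act s a.
    by rewrite !actE => /val_inj/perm_inj e; move: l03; rewrite e ltnn.
  exists a, b, c, d; rewrite /= in e01 e03 e23; have := ltn_ord d.
  split; lia.
have [lta [ltb [ltc ltd]]] : a < n /\ b < n /\ c < n /\ d < n by lia.
exists [ffun i : 'I_4 => nth (Ordinal lta)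
  [:: Ordinal lta; Ordinal ltb; Ordinal ltc; Ordinal ltd] i].
apply/forallP => i; apply/forallP => j; apply/implyP.
rewrite !ffunE -!actE.
by case: i => -[|[|[|[|i]]]] //= _; case: j => -[|[|[|[|j]]]] //= _; lia.
Qed.

(** Crossing arcs [i < j < s i < s j] have the values [s i, s j, i, j] at these
    four positions: a 3412.  Conversely, given a 3412 at [a < b < c < d], the
    position [b] cannot lie under the arc from [a], so [s a <= b]; symmetrically
    [c <= s d].  Hence [s a <= b < c <= s d], against [s d < s a]. *)
Lemma I3412P n (s : 'S_n) : reflect (noncrossing n (act s)) (s \in I3412 n).
Proof.
rewrite inE /avoids; apply: (iffP andP) => [[inv av]|[fb fi fn]].
  split; [exact: act_bound|exact: act_inv|move=> i j lt_in ijf].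
  rewrite ltnNge; apply: contra av => le_fij; apply/contains3412P.
  have lt_fi := act_bound s lt_in.
  have lt_jn : j < n by lia.
  have ne : act s i != act s j.
    by apply/eqP => e; move: (act_inv inv lt_in); rewrite e act_inv //; lia.
  exists i, j, (act s i), (act s j); rewrite !act_inv //.
  by have := act_bound s lt_jn; split; lia.
split.
  by apply/forallP => i; apply/eqP/val_inj; rewrite /= -!actE fi.
apply/contains3412P => -[a [b [c [d [abc cd v1 v2]]]]].
have fab : act s a <= b by rewrite leqNgt; apply/negP => ?; have := fn a b; lia.
have fdc : c <= act s d.
  rewrite leqNgt; apply/negP => fdc.
  have := fn (act s c) (act s d); rewrite !fi; lia.
lia.
Qed.

(** * Decomposition at the first block *)

Definition dsum b (f g : nat -> nat) (i : nat) : nat :=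
  if i < b then f i else b + g (i - b).

(** [f] shifted by one, under an arc joining [0] and [k.+1]. *)
Definition enclose k (f : nat -> nat) (i : nat) : nat :=
  if i == 0 then k.+1 else if i == k.+1 then 0 else (f i.-1).+1.

Definition rlmin_fun n (f : nat -> nat) : nat :=
  \sum_(i < n) [forall j : 'I_n, (i < j) ==> (f i < f j)].

Lemma rlmin_act n (s : 'S_n) : rlmin s = rlmin_fun n (act s).
Proof.
rewrite /rlmin -sum1_card big_mkcond; apply: eq_bigr => i _.
rewrite inE; under eq_forallb => j do rewrite -!actE.
by case: [forall j, _].
Qed.

Lemma eq_rlmin_fun n f g :
  (forall i, i < n -> f i = g i) -> rlmin_fun n f = rlmin_fun n g.
Proof.
move=> fg; apply: eq_bigr => i _; congr nat_of_bool.
by apply: eq_forallb => j; rewrite !fg.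
Qed.

Lemma noncrossing_block b f :
  noncrossing b.+1 f -> f 0 = b -> f b = 0.
Proof. by case=> _ fi _ f0; rewrite -{1}f0 fi. Qed.

(** All values on the first summand lie below all those on the second one, so
    no right-to-left minimum is gained or lost. *)
Lemma rlmin_dsum b m f g : (forall i, i < b -> f i < b) ->
  rlmin_fun (b + m) (dsum b f g) = rlmin_fun b f + rlmin_fun m g.
Proof.
move=> fb; rewrite /rlmin_fun big_split_ord /=; have ltb k : (b + k < b) = false by lia.
congr (_ + _).
  apply: eq_bigr => i _; congr nat_of_bool.
  apply/forallP/forallP => H j.
    by have := H (lshift m j); rewrite /dsum /= !ltn_ord.
  rewrite /dsum /= !ltn_ord; case: (ltnP j b) => jb; first exact: (H (Ordinal jb)).
  by have := fb i (ltn_ord i); lia.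
apply: eq_bigr => i _; congr nat_of_bool.
apply/forallP/forallP => H j.
  by have := H (rshift b j); rewrite /dsum /= !ltb !addKn !ltn_add2l.
rewrite /dsum /= ltb addKn; case: (ltnP j b) => jb; first by lia.
have lt_jm : j - b < m by have := ltn_ord j; lia.
by have := H (Ordinal lt_jm); rewrite /=; lia.
Qed.

(** The least value comes last. *)
Lemma rlmin_block b f : f b = 0 -> rlmin_fun b.+1 f = 1.
Proof.
move=> fb; rewrite /rlmin_fun big_ord_recr /= big1 => [|i _].
  by apply/eqP; rewrite add0n eqb1; apply/forallP => j; have := ltn_ord j; lia.
apply/eqP; rewrite eqb0; apply/forallPn; exists ord_max.
by rewrite /= fb ltn_ord.
Qed.

Lemma noncrossing_dsum b m f g :
  noncrossing b f -> noncrossing m g -> noncrossing (b + m) (dsum b f g).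
Proof.
move=> [fb fi fn] [gb gi gn]; rewrite /dsum; split=> [i lt_in|i lt_in|i j lt_in].
- by case: (ltnP i b) => ib; [have := fb i | have := gb (i - b)]; lia.
- case: (ltnP i b) => ib; first by rewrite fb ?fi.
  by rewrite ltnNge leq_addr /= addKn gi; lia.
- case: (ltnP i b) => ib ijf.
    by have := fb i; have := fn i j; case: (ltnP j b); lia.
  by have := gn (i - b) (j - b); case: (ltnP j b); lia.
Qed.

(** A point under the arc of [0] cannot be joined to a point outside; the
    converse follows because [f] is an involution. *)
Lemma first_block_closed b m f : noncrossing (b.+1 + m) f -> f 0 = b ->
  forall i, i < b.+1 + m -> (f i < b.+1) = (i < b.+1).
Proof.
move=> [fb fi fn] f0 i ibm.
have closed k : k < b.+1 -> f k < b.+1.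
  move=> kb; have := fn 0 k; have := fi 0.
  case: (posnP k) => [->|]; first by lia.
  case: (ltngtP k b) => [||->]; [lia|lia|].
  by rewrite f0 => _ ->.
apply/idP/idP => [/closed|]; [by rewrite fi|exact: closed].
Qed.

Lemma noncrossing_first b m f : noncrossing (b.+1 + m) f -> f 0 = b ->
  noncrossing b.+1 f.
Proof.
move=> nc f0; have cl := first_block_closed nc f0; case: nc => fb fi fn.
split=> [i lt_in|i lt_in|i j lt_in ijf]; have := cl i.
- by lia.
- by rewrite fi; lia.
- by have := fn i j; lia.
Qed.

Lemma noncrossing_rest b m f : noncrossing (b.+1 + m) f -> f 0 = b ->
  noncrossing m (fun i => f (b.+1 + i) - b.+1).
Proof.
move=> nc f0; have cl := first_block_closed nc f0; case: nc => fb fi fn.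
split=> [i lt_in|i lt_in|i j lt_in ijf]; have := cl (b.+1 + i).
- by have := fb (b.+1 + i); lia.
- by move=> ?; rewrite subnKC ?fi; lia.
- by have := fn (b.+1 + i) (b.+1 + j); have := cl (b.+1 + j); lia.
Qed.

Lemma dsum_first_rest b m f : noncrossing (b.+1 + m) f -> f 0 = b ->
  forall i, i < b.+1 + m -> dsum b.+1 f (fun i => f (b.+1 + i) - b.+1) i = f i.
Proof.
move=> nc f0 i lt_in; have := first_block_closed nc f0 lt_in.
by rewrite /dsum; case: (ltnP i _) => // ib fib; rewrite (subnKC ib) subnKC //; lia.
Qed.

Lemma noncrossing_enclose k f : noncrossing k f -> noncrossing k.+2 (enclose k f).
Proof.
move=> [fb fi fn]; rewrite /enclose; split=> [[|i]|[|i]|[|i] [|j]] //=.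
- by rewrite eqSS; case: eqP; have := fb i; lia.
- by rewrite eqxx.
- rewrite !eqSS => lt_i; case: (i =P k) => [->//|ik] /=.
  have lt_ik : i < k by lia.
  by have := fb i lt_ik; rewrite eqSS fi //; case: eqP; lia.
- by rewrite !eqSS; have := fb j; case: eqP; lia.
- by rewrite !eqSS; have := fb i; have := fn i j; do 2 case: eqP => //=; lia.
Qed.

Lemma noncrossing_inside k f : noncrossing k.+2 f -> f 0 = k.+1 ->
  noncrossing k (fun i => (f i.+1).-1).
Proof.
move=> nc f0; have fk := noncrossing_block nc f0; case: nc => fb fi fn.
have in_in i : i < k -> 0 < f i.+1 < k.+1.
  move=> ik; have := fi i.+1; have := fn 0 i.+1.
  by case: (f i.+1) => [|l]; rewrite ?f0; lia.
split=> [i lt_in|i lt_in|i j lt_in ijf]; have := in_in i.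
- by lia.
- by move=> ?; rewrite prednK ?fi; lia.
- by have := in_in j; have := fn i.+1 j.+1; have := fb i.+1; lia.
Qed.

Lemma enclose_inside k f : noncrossing k.+2 f -> f 0 = k.+1 ->
  forall i, i < k.+2 -> enclose k (fun i => (f i.+1).-1) i = f i.
Proof.
move=> nc f0 [|i] lt_in; rewrite /enclose /= ?f0 // eqSS.
have fk := noncrossing_block nc f0.
case: eqP => [->//|ik]; case: nc => _ fi _.
by have := fi i.+1; case: (f i.+1) => // ; rewrite f0; lia.
Qed.

(** * The recurrence *)

Lemma reindex_bij_in (V : nmodType) (I J : finType) (P : pred I) (Q : pred J)
    (h : J -> I) (h' : I -> J) (F : I -> V) :
    (forall j, Q j -> P (h j)) -> (forall i, P i -> Q (h' i)) ->
    (forall j, Q j -> h' (h j) = j) -> (forall i, P i -> h (h' i) = i) ->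
  (\sum_(i | P i) F i = \sum_(j | Q j) F (h j))%R.
Proof.
move=> QP PQ hK h'K; rewrite (reindex_onto h h') //; apply: eq_bigl => j.
apply/andP/idP => [[Pj /eqP <-]|Qj]; first exact: PQ.
by rewrite hK ?QP.
Qed.

(** The weight [q] is kept general, because the recurrence for [q] also
    involves the plain counting sequence, which is the case [q = 1]. *)
Definition rlmin_gf (R : comNzRingType) (q : R) n : R :=
  (\sum_(s in I3412 n) q ^+ rlmin s)%R.

(** The possible shapes of a first block of size [b.+1]: the arc of [0], or the
    fixed point [0] when [b = 0], spans everything. *)
Definition first_blocks b : {set 'S_b.+1} := [set s in I3412 b.+1 | act s 0 == b].

(** Splitting [s] after its first block is a bijection, with inverse [dsum]; the
    factor [q] accounts for the single right-to-left minimum of the block. *)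
Lemma sum_first_block (R : comNzRingType) (q : R) b m :
  (\sum_(s in I3412 (b.+1 + m) | act s 0%N == b) q ^+ rlmin s
     = q * (#|first_blocks b|%:R * rlmin_gf q m))%R.
Proof.
pose Q (p : 'S_b.+1 * 'S_m) := (p.1 \in first_blocks b) && (p.2 \in I3412 m).
pose h (p : 'S_b.+1 * 'S_m) :=
  perm_of_fun (b.+1 + m) (dsum b.+1 (act p.1) (act p.2)).
pose rest (s : 'S_(b.+1 + m)) i := act s (b.+1 + i) - b.+1.
pose h' (s : 'S_(b.+1 + m)) := (perm_of_fun b.+1 (act s), perm_of_fun m (rest s)).
have ncQ p : Q p -> [/\ noncrossing b.+1 (act p.1), act p.1 0 = b,
    noncrossing m (act p.2)
    & noncrossing (b.+1 + m) (dsum b.+1 (act p.1) (act p.2))].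
  rewrite /Q inE => /andP[/andP[/I3412P nc1 /eqP p0] /I3412P nc2].
  by split=> //; apply: noncrossing_dsum.
rewrite (reindex_bij_in (Q := Q) (h := h) (h' := h')).
- have rl p : Q p -> rlmin (h p) = (rlmin p.2).+1.
    case/ncQ => nc1 p0 nc2 nc; rewrite !rlmin_act.
    rewrite (eq_rlmin_fun (g := dsum b.+1 (act p.1) (act p.2))) => [|i]; last first.
      exact: act_perm_of_fun.
    rewrite rlmin_dsum; last by case: nc1.
    by rewrite rlmin_block // noncrossing_block.
  under eq_bigr => p Qp do rewrite (rl p Qp) exprS.
  rewrite -mulr_sumr.
  rewrite -(pair_big (mem (first_blocks b)) (mem (I3412 m))
                     (fun _ s => q ^+ rlmin s)%R) /=.
  by rewrite sumr_const mulr_natl.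
- move=> p /ncQ[nc1 p0 nc2 nc]; apply/andP; split.
    by apply/I3412P/noncrossing_perm_of_fun.
  by rewrite act_perm_of_fun // /dsum p0.
- move=> s /andP[/I3412P nc /eqP s0]; rewrite /Q inE -andbA; apply/and3P; split.
  + by apply/I3412P/noncrossing_perm_of_fun; exact: noncrossing_first nc s0.
  + by rewrite act_perm_of_fun ?s0 //; exact: noncrossing_first nc s0.
  + by apply/I3412P/noncrossing_perm_of_fun/noncrossing_rest.
- move=> p Qp; have [nc1 p0 nc2 nc] := ncQ p Qp.
  have hE i : i < b.+1 + m -> act (h p) i = dsum b.+1 (act p.1) (act p.2) i.
    exact: act_perm_of_fun.
  have nch := noncrossing_perm_of_fun nc.
  have h0 : act (h p) 0 = b by rewrite hE.
  rewrite (surjective_pairing p); congr (_, _); apply: act_inj => i lt_i.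
    rewrite act_perm_of_fun //; last exact: noncrossing_first nch h0.
    by rewrite hE ?ltn_addr // /dsum lt_i.
  rewrite act_perm_of_fun //; last exact: noncrossing_rest nch h0.
  by rewrite /rest hE ?ltn_add2l // /dsum ltnNge leq_addr /= !addKn.
- move=> s /andP[/I3412P nc /eqP s0].
  have nc1 := noncrossing_first nc s0; have nc2 := noncrossing_rest nc s0.
  have E i : i < b.+1 + m -> dsum b.+1 (act (h' s).1) (act (h' s).2) i = act s i.
    move=> lt_i; rewrite -[RHS](dsum_first_rest nc s0) // /dsum /h' /=.
    by case: (ltnP i b.+1) => ib; rewrite act_perm_of_fun //; lia.
  apply: act_inj => i lt_i; rewrite act_perm_of_fun ?E //.
  by apply: eq_noncrossing nc => k lt_k; rewrite E.
Qed.

Lemma card_first_blocks0 : #|first_blocks 0| = 1.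
Proof.
suff -> : first_blocks 0 = [set 1%g] by rewrite cards1.
apply/setP => s; rewrite !inE.
have -> : s = 1%g by apply/permP => i; rewrite !ord1.
rewrite eqxx; apply/andP; split; last by have := @act_bound 1 1%g 0 isT; lia.
suff: 1%g \in I3412 1 by rewrite inE.
apply/I3412P; have actE0 i : i < 1 -> act (1%g : 'S_1) i = i.
  by move=> lt_i; have := @act_bound 1 1%g i lt_i; lia.
by split=> [i lt_i|i lt_i|i j lt_i]; have E := actE0 i lt_i; rewrite ?E //; lia.
Qed.

(** Removing the outer arc is a bijection, with inverse [enclose]. *)
Lemma card_first_blocksS k : #|first_blocks k.+1| = #|I3412 k|.
Proof.
pose h (s : 'S_k) := perm_of_fun k.+2 (enclose k (act s)).
pose h' (s : 'S_k.+2) := perm_of_fun k (fun i => (act s i.+1).-1).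
rewrite -!sum1_card; apply: (reindex_bij_in (h := h) (h' := h')) => s.
- move=> /I3412P/noncrossing_enclose nc; rewrite inE.
  rewrite act_perm_of_fun // eqxx andbT.
  exact/I3412P/noncrossing_perm_of_fun.
- rewrite inE => /andP[/I3412P nc /eqP s0].
  exact/I3412P/noncrossing_perm_of_fun/noncrossing_inside.
- move=> /I3412P nc; have /noncrossing_perm_of_fun nch := noncrossing_enclose nc.
  have hE i : i < k.+2 -> act (h s) i = enclose k (act s) i.
    exact/act_perm_of_fun/noncrossing_enclose.
  apply: act_inj => i lt_i; rewrite act_perm_of_fun ?hE ?ltnS ?(ltnW lt_i) //; last first.
    by apply: noncrossing_inside nch _; rewrite hE.
  by rewrite /enclose /= eqSS ltn_eqF.
- rewrite inE => /andP[/I3412P nc /eqP s0].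
  have E i : i < k.+2 -> enclose k (act (h' s)) i = act s i.
    move=> lt_i; rewrite -[RHS](enclose_inside nc s0) // /enclose /h'.
    case: i lt_i => [//|i] lt_i /=; case: eqP => // ik.
    by rewrite act_perm_of_fun //; [exact: noncrossing_inside|lia].
  apply: act_inj => i lt_i; rewrite act_perm_of_fun ?E //.
  by apply: eq_noncrossing nc => j lt_j; rewrite E.
Qed.

Lemma rlmin_gf0 (R : comNzRingType) (q : R) : rlmin_gf q 0 = 1%R.
Proof.
rewrite /rlmin_gf (bigD1 1%g) /=; last by apply/I3412P; split.
rewrite rlmin_act /rlmin_fun big_ord0 expr0 big1 ?addr0 // => s /andP[_ /eqP[]].
by apply/permP => -[].
Qed.

Lemma rlmin_gf1 (R : comNzRingType) n :
  rlmin_gf (1 : R)%R n = (#|I3412 n|%:R)%R.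
Proof.
by rewrite /rlmin_gf -sumr_const; apply: eq_bigr => s _; rewrite expr1n.
Qed.

(** Sum over the size of the first block: the first term is a fixed point [0],
    the [k]-th term of the sum an arc enclosing [k] points. *)
Lemma rlmin_gfS (R : comNzRingType) (q : R) n :
  (rlmin_gf q n.+1 = q * rlmin_gf q n
     + q * \sum_(k < n) rlmin_gf 1 k * rlmin_gf q (n.-1 - k))%R.
Proof.
have first (s : 'S_n.+1) : act s 0 < n.+1 by exact: act_bound.
rewrite {1}/rlmin_gf (partition_big (fun s => Ordinal (first s)) xpredT) //=.
transitivity (\sum_(b < n.+1) q * (#|first_blocks b|%:R * rlmin_gf q (n - b)))%R.
  apply: eq_bigr => b _; rewrite -sum_first_block addSn subnKC ?leq_ord //.
rewrite big_ord_recl card_first_blocks0 mul1r subn0; congr (_ + _)%R; rewrite mulr_sumr.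
apply: eq_bigr => k _; rewrite card_first_blocksS rlmin_gf1.
by rewrite lift0 -[n.-1]subn1 -subnDA add1n.
Qed.

(** * Left-to-right maxima *)

Local Open Scope ring_scope.

(** The graph of [s^-1] is the mirror image of that of [s] in the main diagonal,
    which exchanges up-left and down-right: the record at position [i] of value
    [s i] becomes one at position [s i] of value [i]. *)
Lemma lrmax_rlminV n (s : 'S_n) : lrmax s = rlmin s^-1%g.
Proof.
rewrite /lrmax /rlmin -(card_imset _ (@perm_inj _ s)); apply: eq_card => k.
apply/imsetP/idP => [[i]|]; rewrite !inE => /forallP H.
  move=> ->; apply/forallP => j; rewrite permK; apply/implyP; apply: contraLR.
  rewrite -!leqNgt leq_eqVlt => /predU1P[/val_inj <-|lt_j]; first by rewrite permKV.
  by apply: ltnW; have := H (s^-1%g j); rewrite permKV lt_j.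
exists (s^-1%g k); last by rewrite permKV.
rewrite inE; apply/forallP => j; rewrite permKV; apply/implyP; apply: contraLR.
rewrite -!leqNgt leq_eqVlt => /predU1P[/val_inj ->|lt_j]; first by rewrite permK.
by apply: ltnW; have := H (s j); rewrite permK lt_j.
Qed.

Lemma lrmax_rlmin n (s : 'S_n) : perm_involution s -> lrmax s = rlmin s.
Proof.
move=> /forallP inv; rewrite lrmax_rlminV; congr rlmin.
by apply/permP => i; rewrite -[i in LHS](eqP (inv i)) permK.
Qed.

(** * Power series and the continued fraction *)

Section PowerSeries.
Variable R : comUnitRingType.
Implicit Types (f g : fps R) (c : R).

Lemma coef_fpsXM f n : (fpsX * f) n = if n is m.+1 then f m else 0.
Proof.
rewrite [LHS]big_ord_recl mul0r add0r.
case: n => [|n]; first by rewrite big_ord0.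
rewrite big_ord_recl mul1r subSS subn0 big1 ?addr0 // => i _.
by rewrite mul0r.
Qed.

Lemma coef_fpsCM c f n : (fpsC c * f) n = c * f n.
Proof.
rewrite [LHS]big_ord_recl subn0 big1 ?addr0 // => i _.
by rewrite mul0r.
Qed.

Lemma fpsX_unit f : 1 - fpsX * f \is a GRing.unit.
Proof.
have e : (1 - fpsX * f) 0%N = 1 by rewrite -[LHS]/(1 - (fpsX * f) 0%N) coef_fpsXM subr0.
by rewrite unfold_in /= /fps_unit e unitr1.
Qed.

(** Congruence modulo [x^N], in the form that [ring] can use. *)
Definition fps_congr N f g := exists h, f = g + fpsX ^+ N * h.

Lemma fps_congr_coef N f g n : fps_congr N f g -> (n < N)%N -> f n = g n.
Proof.
case=> h -> lt_nN; rewrite -[LHS]/(g n + (fpsX ^+ N * h) n).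
suff -> : (fpsX ^+ N * h) n = 0 by rewrite addr0.
elim: N n lt_nN => // N IHN n; rewrite exprS -mulrA coef_fpsXM.
by case: n => // n /IHN.
Qed.

(** From [f^-1 - g^-1 = (g - f) / (f g)]. *)
Lemma fps_congrV N f g : f \is a GRing.unit -> g \is a GRing.unit ->
  fps_congr N f g -> fps_congr N f^-1 g^-1.
Proof.
move=> Uf Ug [h fg]; exists (- (f^-1 * g^-1 * h)).
have gE : g = f - fpsX ^+ N * h by rewrite fg addrK.
rewrite -[LHS]mul1r -(mulVr Ug) -mulrA [X in _ * (X * _)]gE mulrBl divrr //.
by ring.
Qed.

Definition rlmin_fps c : fps R := FPS (rlmin_gf c).

(** The recurrence [rlmin_gfS], read as an equation between series and solved
    for the factor [rlmin_fps c] that both of its last terms contain. *)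
Lemma rlmin_fpsE c :
  rlmin_fps c
    = (1 - fpsX * fpsC c - fpsX ^+ 2 * fpsC c * rlmin_fps 1)^-1.
Proof.
have E : rlmin_fps c = 1 + (fpsX * (fpsC c * rlmin_fps c)
    + fpsX * (fpsX * (fpsC c * (rlmin_fps 1 * rlmin_fps c)))).
  apply: fpsP => n; rewrite -[RHS]/((1 : fps R) n + ((fpsX * _) n + (fpsX * _) n)).
  rewrite !coef_fpsXM; case: n => [|n]; first by rewrite [LHS]rlmin_gf0 !addr0.
  rewrite coef_fpsXM [LHS]rlmin_gfS [RHS]add0r !coef_fpsCM; congr (_ + _).
  by case: n => [|n]; rewrite ?big_ord0 ?mulr0 // coef_fpsCM.
symmetry; apply: mulr1_eq; rewrite -[RHS](addrK (rlmin_fps c - 1)) {3}E; ring.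
Qed.

End PowerSeries.

(** The tails starting at any index from 2 on coincide, and the one starting at
    index 1 differs from them by a factor [q] in its first numerator only; all
    are given by one approximation [f] of [rlmin_fps 1].  Passing from [m] to
    [m.+1] multiplies the error by [x^2] and a unit; one power of [x] is kept. *)
Lemma cf_tail m : exists f,
  [/\ fps_congr m f (rlmin_fps 1),
      forall j, cfrac cf_num cf_den m j.+2 = xvar ^+ 2 * f
    & cfrac cf_num cf_den m 1 = xvar ^+ 2 * qvar * f].
Proof.
elim: m => [|m [f [fM fE _]]].
  exists (1 - xvar)^-1; split=> //.
  by exists ((1 - xvar)^-1 - rlmin_fps 1); rewrite mul1r [RHS]addrC subrK.
exists (1 - xvar - xvar ^+ 2 * f)^-1; split=> [|j|] /=; rewrite ?fE //.
rewrite [rlmin_fps 1]rlmin_fpsE.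
have -> : fpsC 1 = 1 :> fps {poly int} by [].
apply: fps_congrV.
- have -> : 1 - xvar - xvar ^+ 2 * f = 1 - fpsX * (1 + fpsX * f) :> fps {poly int}
    by rewrite /xvar; ring.
  exact: fpsX_unit.
- have -> : 1 - fpsX * 1 - fpsX ^+ 2 * 1 * rlmin_fps 1
      = 1 - fpsX * (1 + fpsX * rlmin_fps 1) :> fps {poly int} by ring.
  exact: fpsX_unit.
by case: fM => h ->; exists (- (xvar * h)); rewrite /xvar [fpsX ^+ m.+1]exprS; ring.
Qed.

(** [rlmin_fpsE] for ['X], with [rlmin_fps 1] replaced by its approximation. *)
Lemma cfrac_congr m :
  fps_congr m (cfrac cf_num cf_den m.+1 0) (rlmin_fps 'X).
Proof.
have [f [[h fM] _ fE]] := cf_tail m; rewrite /= fE mul1r.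
rewrite [rlmin_fps 'X]rlmin_fpsE.
have U (g : fps {poly int}) :
    1 - fpsX * fpsC 'X - fpsX ^+ 2 * fpsC 'X * g \is a GRing.unit.
  have -> : 1 - fpsX * fpsC 'X - fpsX ^+ 2 * fpsC 'X * g
    = 1 - fpsX * (fpsC 'X + fpsX * fpsC 'X * g) :> fps {poly int} by ring.
  exact: fpsX_unit.
apply: fps_congrV; [exact: U | exact: U |].
by exists (- (xvar ^+ 2 * qvar * h)); rewrite fM /xvar /qvar; ring.
Qed.

Local Close Scope ring_scope.

Theorem corollary3p8 :
  I3412_gf lrmax = I3412_gf rlmin /\
  fps_cvg (fun m : nat => cfrac cf_num cf_den m 0) (I3412_gf rlmin).
Proof.
split.
  apply: fpsP => n; apply: eq_bigr => s; rewrite inE => /andP[inv _].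
  by rewrite lrmax_rlmin.
move=> n; exists n.+2 => -[//|m] lt_nm.
exact: fps_congr_coef (cfrac_congr m) lt_nm.
Qed.
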